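(* Let $d\ge1$ and let $\mathbf a=(a_1,\ldots,a_p)\in(\mathbb Z_+)^p$ be a vector of positive integers with $p\ge d$. Then $$h^{\Delta}\le h^{\Delta_{\max}(d,p,\mathbf a)}\quad\text{componentwise, for all }\Delta\in\mathcal M(d,p,\mathbf a).$$
   Context: A matroid on $[n]=\{1,\ldots,n\}$ is identified with its simplicial complex $\Delta$ of independent sets (a simplicial complex such that for $F,G\in\Delta$ with $|F|<|G|$ there is $i\in G\setminus F$ with $F\cup\{i\}\in\Delta$); every $v\in[n]$ is assumed to be a vertex of $\Delta$. The $1$-skeleton of a matroid, viewed as a graph on $[n]$ whose edges are the two-element faces, is a complete $p$-partite graph for some $p$. For a vector $\mathbf a=(a_1,\ldots,a_p)$ of positive integers with $a_1+\cdots+a_p=n$ and $p\ge d$, $\mathcal M(d,p,\mathbf a)$ is the class of all $(d-1)$-dimensional matroids on $[n]$ whose $1$-skeleton is complete $p$-partite with partition sets $A_1,\ldots,A_p$ of cardinalities $|A_i|=a_i$. $\Delta_{\max}(d,p,\mathbf a)=\Delta_0(d,p,\mathbf a)$ is the complete $p$-partite matroid: the simplicial complex generated by all sets $\{v_{i_1},\ldots,v_{i_d}\}$ with $1\le i_1<\cdots<i_d\le p$ and $v_{i_j}\in A_{i_j}$, where $A_1,\ldots,A_p$ is a partition of $[n]$ with $|A_i|=a_i$. $\Bbbk$ is a field, $S=\Bbbk[x_1,\ldots,x_n]$, $J(\Delta)=\bigcap_{F\text{ facet of }\Delta}(x_i : i\in F)$ is the cover ideal, and $h^\Delta$ is the $h$-vector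 of $S/J(\Delta)$, i.e. the coefficient vector of the polynomial $h(t)$ with Hilbert series of $S/J(\Delta)$ equal to $h(t)/(1-t)^{\dim S/J(\Delta)}$ (entries outside the range are $0$). *)

(* Defs.v *)
From mathcomp Require Import all_boot all_order all_algebra.
From mathcomp Require Import mpoly.

Set Implicit Arguments.
Unset Strict Implicit.
Unset Printing Implicit Defensive.

Import GRing.Theory.
Local Open Scope ring_scope.

(* The ground set [n] is 'I_n; a complex is the set of its faces. *)
Section Complexes.
Variable n : nat.
Implicit Type D : {set {set 'I_n}}.

Definition simplicial_complex D : Prop :=
  set0 \in D /\ forall F G : {set 'I_n}, F \in D -> G \subset F -> G \in D.

(* The last clause says that every element of the ground set is a vertex. *)
Definition matroid_complex D : Prop :=
  [/\ simplicial_complex D,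
      forall F G : {set 'I_n}, F \in D -> G \in D -> (#|F| < #|G|)%N ->
        exists2 i, i \in G :\: F & i |: F \in D
    & forall v : 'I_n, [set v] \in D].

(* dim D = max_F #|F| - 1; this is dim D + 1. *)
Definition max_face_card D : nat := \max_(F in D) #|F|.

Definition facets D : {set {set 'I_n}} :=
  [set F | maxset (fun G : {set 'I_n} => G \in D) F].

Definition generated_complex (gens : {set {set 'I_n}}) : {set {set 'I_n}} :=
  [set F : {set 'I_n} | [exists G in gens, F \subset G]].

Definition skeleton_edge D : rel 'I_n :=
  fun u v => (u != v) && ([set u; v] \in D).

Definition partition_of_type p (a : 'I_p -> nat) (A : 'I_p -> {set 'I_n}) :
    Prop :=
  [/\ forall i, #|A i| = a i,
      forall i j, i != j -> [disjoint A i & A j]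
    & \bigcup_i A i = [set: 'I_n]].

Definition complete_partite p (A : 'I_p -> {set 'I_n}) (E : rel 'I_n) : Prop :=
  forall u v, E u v = ~~ [exists i, (u \in A i) && (v \in A i)].

Definition matroid_class d p (a : 'I_p -> nat) D : Prop :=
  [/\ matroid_complex D, max_face_card D = d
    & exists A : 'I_p -> {set 'I_n},
        partition_of_type a A /\ complete_partite A (skeleton_edge D)].

(* A generator is the image of a choice function v_i \in A_i restricted to a
   d-subset I of the indices. *)
Definition complete_partite_matroid d p (A : 'I_p -> {set 'I_n}) :
    {set {set 'I_n}} :=
  generated_complex
    [set G : {set 'I_n} |
      [exists I : {set 'I_p}, exists v : {ffun 'I_p -> 'I_n},
        [&& #|I| == d, [forall i in I, v i \in A i] & G == v @: I]]].

End Complexes.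

Section Ideals.
Variables (K : fieldType) (n : nat).
Implicit Type I : {mpoly K[n]} -> Prop.

Definition var_ideal (F : {set 'I_n}) (q : {mpoly K[n]}) : Prop :=
  exists c : 'I_n -> {mpoly K[n]}, q = \sum_(i in F) c i * 'X_i.

Definition cover_ideal (D : {set {set 'I_n}}) (q : {mpoly K[n]}) : Prop :=
  forall F, F \in facets D -> var_ideal F q.

(* Prime ideals of S/I are taken as prime ideals of S containing I;
   [idealr_closed] includes properness. *)
Definition prime_chain I (l : nat) (P : nat -> {pred {mpoly K[n]}}) : Prop :=
  [/\ forall i, (i <= l)%N -> idealr_closed (P i) /\ prime_idealr_closed (P i),
      forall i, (i < l)%N ->
        {subset P i <= P i.+1} /\ ~ {subset P i.+1 <= P i}
    & forall q, I q -> q \in P 0%N].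

Definition krull_dim_quotient I (e : nat) : Prop :=
  (exists P, prime_chain I e P) /\
  (forall l P, prime_chain I l P -> (l <= e)%N).

(* H k = dim_K (S/I)_k: the classes of b_1, ..., b_(H k) are a basis of the
   quotient of the space of k-forms by the k-forms in I. *)
Definition hilbert_function_quotient I (H : nat -> nat) : Prop :=
  forall k, exists b : 'I_(H k) -> {mpoly K[n]},
    (forall j, b j \is k.-homog) /\
    (forall q : {mpoly K[n]}, q \is k.-homog ->
       exists! c : {ffun 'I_(H k) -> K}, I (q - \sum_j c j *: b j)).

(* h(t) = (1 - t)^e * sum_k (H k) t^k as formal power series, e = dim S/I.
   The h-vector of S/I is the coefficient sequence of h. *)
Definition h_polynomial_quotient I (h : {poly int}) : Prop :=
  exists e H,
    [/\ krull_dim_quotient I e, hilbert_function_quotient I H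
      & forall k, h`_k =
          \sum_(j < k.+1) ((1 - 'X : {poly int}) ^+ e)`_j * (H (k - j)%N)%:Z].

End Ideals.

(* h_polynomial_quotient determines h, for linear subspaces I. *)
Section Uniqueness.
Variables (K : fieldType) (n : nat) (I : {mpoly K[n]} -> Prop).
Hypothesis I0 : I 0.
Hypothesis Ilin : forall c p q, I p -> I q -> I (c *: p + q).

Lemma hilbert_function_quotient_le H H' :
  hilbert_function_quotient I H -> hilbert_function_quotient I H' ->
  forall k, (H k <= H' k)%N.
Proof.
move=> hH hH' k; have [b [bk bP]] := hH k; have [b' [_ bP']] := hH' k.
rewrite leqNgt; apply/negP => lt.
have /fin_all_exists [c cP] : forall i, exists c : {ffun 'I_(H' k) -> K},
    I (b i - \sum_j c j *: b' j).
  by move=> i; have [c [cP _]] := bP' _ (bk i); exists c.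
pose M := \matrix_(i, j) c i j.
have [u u0 uM] : exists2 u : 'rV[K]_(H k), u != 0 & u *m M = 0.
  have : kermx M != 0.
    rewrite kermx_eq0 /row_free neq_ltn (leq_ltn_trans (rank_leq_col _)) //.
  case/rowV0Pn => u /sub_kermxP; by exists u.
have Isum (r : seq 'I_(H k)) (f : 'I_(H k) -> {mpoly K[n]}) (s : 'I_(H k) -> K) :
    (forall i, I (f i)) -> I (\sum_(i <- r) s i *: f i).
  by move=> If; elim: r => [|i r IH]; rewrite ?big_nil ?big_cons //; apply: Ilin.
have Iu : I (0 - \sum_j [ffun j => - u 0 j] j *: b j).
  have := Isum (index_enum _) _ (u 0) cP; congr I.
  under eq_bigr do rewrite scalerBr.
  rewrite sumrB sub0r; under [in RHS]eq_bigr do rewrite ffunE scaleNr.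
  rewrite sumrN opprK; apply/eqP; rewrite subr_eq -subr_eq0 opprD addNKr oppr_eq0.
  apply/eqP.
  under eq_bigr do rewrite scaler_sumr.
  rewrite exchange_big /= big1 // => j _.
  under eq_bigr do rewrite scalerA.
  rewrite -scaler_suml; have /matrixP/(_ 0 j) := uM; rewrite !mxE => uj.
  by rewrite -[RHS](scale0r (b' j)) -[in RHS]uj; congr (_ *: _);
    apply: eq_bigr => i _; rewrite mxE.
have [c0 [_ c0P]] := bP 0 (dhomog0 _ _ _).
have e1 := c0P _ Iu.
have e2 : c0 = 0.
  by apply: c0P; rewrite big1 ?subr0 // => j _; rewrite ffunE scale0r.
case/eqP: u0; apply/rowP => j; rewrite mxE.
by have /ffunP/(_ j) := e1; rewrite e2 !ffunE => /eqP; rewrite eq_sym oppr_eq0 => /eqP.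
Qed.

Lemma h_polynomial_quotient_uniq h h' :
  h_polynomial_quotient I h -> h_polynomial_quotient I h' -> h = h'.
Proof.
move=> [e [H [[[P Pe] eM] hH hE]]] [e' [H' [[[P' Pe'] eM'] hH' hE']]].
have ee : e = e' by apply/eqP; rewrite eqn_leq (eM' _ _ Pe) (eM _ _ Pe').
apply/polyP => k; rewrite hE hE' ee; apply: eq_bigr => j _.
by congr (_ * Posz _); apply/eqP; rewrite eqn_leq !hilbert_function_quotient_le.
Qed.

End Uniqueness.

Lemma cover_h_polynomial_uniq (K : fieldType) n (D : {set {set 'I_n}}) h h' :
  h_polynomial_quotient (@cover_ideal K n D) h ->
  h_polynomial_quotient (@cover_ideal K n D) h' -> h = h'.
Proof.
apply: h_polynomial_quotient_uniq => [F _|c p q Ip Iq F FD].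
  by exists (fun=> 0); rewrite big1 // => i _; rewrite mul0r.
have [cp ->] := Ip F FD; have [cq ->] := Iq F FD.
exists (fun i => c *: cp i + cq i); rewrite scaler_sumr -big_split.
by apply: eq_bigr => i _ /=; rewrite mulrDl scalerAl.
Qed.

(* Main.v *)
(* The cover ideal of D is the Stanley-Reisner ideal of the dual matroid D*, whose faces are
   the sets disjoint from some basis of D. Hence dim S/J(D) = n - d, and the h-polynomial is
   h(t) = sum over faces F of D* of t^|F| (1 - t)^(n-d-|F|). Every D in the class is contained,
   with the same rank, in the complete p-partite matroid on the partition of D, so the dual
   complexes are nested too. For nested matroids N in N' of equal rank r one has
   h_N <= h_N' by induction on the ground set, using h_N = h_(N\e) + t h_(N/e) for an e missed
   by some basis of N. Two complete p-partite matroids of the same type differ by a permutation.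

   The upper bound dim S/J(D) <= n - d: choosing f_i in P_(i+1) but not in P_i along a
   chain of primes P_0, ..., P_l gives l elements that are algebraically independent modulo P_0,
   whereas counting monomials shows that S/P_0 has no more than n - d of these. *)
Require Import Defs.
From mathcomp Require Import all_boot all_order all_algebra.
From mathcomp Require Import fingroup perm mpoly.
From mathcomp Require Import ring_quotient zify ring.
From Stdlib Require Import Classical.
Set Implicit Arguments.
Unset Strict Implicit.
Unset Printing Implicit Defensive.
Import Order.TTheory GRing.Theory Num.Theory.
Local Open Scope ring_scope.

(** * h-polynomials of nested matroids *)

Section MatroidHPoly.
Variable T : finType.
Implicit Types (N : {set {set T}}) (E F G B : {set T}) (e : T) (r : nat).

(** The h-polynomial computed from face numbers. The rank [r] is a parameter, since the empty family
    does not determine one. *)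
Definition hpoly r N : {poly int} :=
  \sum_(F in N) 'X^#|F| * (1 - 'X) ^+ (r - #|F|).

(* The empty family is included on purpose: it is the link of a loop, and taking it as the
   smaller family in [hpoly_mono] gives the nonnegativity of the coefficients. *)
Definition matroidal r N : Prop :=
  [/\ forall F G, F \in N -> G \subset F -> G \in N,
      forall F G, F \in N -> G \in N -> (#|F| < #|G|)%N ->
        exists2 i, i \in G :\: F & i |: F \in N,
      forall F, F \in N -> (#|F| <= r)%N
    & N != set0 -> exists2 B, B \in N & #|B| = r].

Definition del N e := [set F in N | e \notin F].
Definition link N e := [set F : {set T} | (e \notin F) && (e |: F \in N)].

(** Repeated exchange adds elements of [B] to [F] until the cardinalities agree. The bound by
    [F :|: B] controls what is added; exchange in the dual relies on it. *)
Lemma exchange_extend N B F :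
    (forall F G, F \in N -> G \in N -> (#|F| < #|G|)%N ->
        exists2 i, i \in G :\: F & i |: F \in N) ->
    B \in N -> F \in N -> (#|F| <= #|B|)%N ->
  exists B', [/\ B' \in N, F \subset B', B' \subset F :|: B & #|B'| = #|B|].
Proof.
move=> exch BN; move: {2}(_ - _)%N (leqnn (#|B| - #|F|)) => k.
elim: k F => [|k IH] F le_k FN le_FB.
  exists F; rewrite subxx subsetUl; split=> //.
  by apply/eqP; rewrite eqn_leq le_FB -subn_eq0 -leqn0.
have [lt_FB | ge_FB] := ltnP #|F| #|B|; last first.
  by exists F; rewrite subxx subsetUl; split=> //; apply/eqP; rewrite eqn_leq le_FB.
have [i] := exch _ _ FN BN lt_FB; rewrite inE => /andP[iF iB] iFN.
have ciF : #|i |: F| = #|F|.+1 by rewrite cardsU1 iF.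
have [||B' [B'N sFB' sB' cB']] := IH (i |: F) _ iFN; rewrite ?ciF //.
  by rewrite subnS -ltnS (leq_trans _ le_k) // prednK // subn_gt0.
exists B'; split=> //; first exact: subset_trans (subsetUr _ _) sFB'.
apply: subset_trans sB' _; rewrite -setUA subUset subxx andbT.
by rewrite sub1set inE iB orbT.
Qed.

(** Removing [e] from the faces that contain it takes off one factor ['X] and lowers rank and
    cardinality together, so the exponent of [1 - 'X] does not change. *)
Lemma hpoly_del_link r N e :
  hpoly r N = hpoly r (del N e) + 'X * hpoly r.-1 (link N e).
Proof.
rewrite /hpoly (bigID (fun F : {set T} => e \in F)) /= addrC; congr (_ + _).
  by apply: eq_bigl => F; rewrite inE.
rewrite big_distrr /=.
rewrite (reindex_onto (fun F => e |: F) (fun F => F :\ e)) /=; last first.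
  by move=> F /andP[_ eF]; rewrite setD1K.
rewrite (eq_bigl (fun F => F \in link N e)) => [|F]; last first.
  rewrite !inE eqxx /= andbT andbC; case: (boolP (e \in F)) => eF /=.
    apply/negbTE/negP => /andP[/eqP eq_F _]; move: eF.
    by rewrite -eq_F !inE eqxx.
  by rewrite setU1K // eqxx.
apply: eq_bigr => F; rewrite inE => /andP[eF _].
by rewrite cardsU1 eF add1n exprS -mulrA -subn1 subnAC subn1 subnS.
Qed.

Lemma hpoly_powerset E : hpoly #|E| (powerset E) = 1.
Proof.
rewrite -[RHS](expr1n _ #|E|) -[X in X ^+ _](subrK 'X) exprDn /hpoly.
rewrite (partition_big (fun F => inord #|F| : 'I_#|E|.+1) predT) //=.
apply: eq_bigr => k _; rewrite mulrC.
transitivity (\sum_(F in [set A : {set T} | A \subset E & #|A| == k])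
   'X^k * (1 - 'X : {poly int}) ^+ (#|E| - k)).
  apply: eq_big => F; rewrite !inE; case: (boolP (F \subset E)) => //= sFE.
    by rewrite -val_eqE /= inordK // ltnS subset_leq_card.
  by move/eqP<-; rewrite inordK // ltnS subset_leq_card.
by rewrite sumr_const cards_draws.
Qed.

Lemma matroidal_del r N e B :
    matroidal r N -> e \notin B -> (N != set0 -> B \in N /\ #|B| = r) ->
  matroidal r (del N e).
Proof.
move=> [dN xN bN _] eB rB; split.
- move=> F G; rewrite !inE => /andP[FN eF] sGF; rewrite (dN _ _ FN) //=.
  by apply: contra eF; apply: (subsetP sGF).
- move=> F G; rewrite !inE => /andP[FN eF] /andP[GN eG] ltFG.
  have [i iGF iFN] := xN _ _ FN GN ltFG; exists i => //.
  move: iGF; rewrite !inE iFN /= negb_or eF andbT => /andP[_ iG].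
  by apply: contra eG => /eqP->.
- by move=> F; rewrite inE => /andP[/bN].
- case/set0Pn => F; rewrite inE => /andP[FN _].
  have [|BN cB] := rB; first by apply/set0Pn; exists F.
  by exists B; rewrite // inE BN.
Qed.

(** If [e] lies in no face, the link is empty. Otherwise [[set e]] extends to a basis, and removing
    [e] from it gives a basis of the link. *)
Lemma matroidal_link r N e : matroidal r N -> matroidal r.-1 (link N e).
Proof.
move=> [dN xN bN rN].
have cU F : e \notin F -> #|e |: F| = #|F|.+1 by move=> eF; rewrite cardsU1 eF.
split.
- move=> F G; rewrite !inE => /andP[eF FN] sGF.
  by rewrite (contra (subsetP sGF e) eF) (dN _ _ FN) // setUS.
- move=> F G; rewrite !inE => /andP[eF FN] /andP[eG GN] ltFG.
  have [|i] := xN _ _ FN GN; first by rewrite !cU.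
  rewrite !inE negb_or => /andP[/andP[ie iF]]; rewrite (negbTE ie) /= => iG iFN.
  by exists i; rewrite !inE ?iF // setUCA iFN eq_sym (negbTE ie) eF.
- move=> F; rewrite inE => /andP[eF /bN]; rewrite cU // => le_r.
  by rewrite -ltnS (leq_trans le_r) // leqSpred.
- case/set0Pn => F; rewrite inE => /andP[eF eFN].
  have [|B BN cB] := rN; first by apply/set0Pn; exists (e |: F).
  have e1N : [set e] \in N by apply: dN eFN _; rewrite subsetUl.
  have [|B' [B'N sB' _ cB']] := exchange_extend xN BN e1N.
    by rewrite cards1 -(cards1 e) cB; apply: bN.
  rewrite sub1set in sB'; exists (B' :\ e).
    by rewrite inE !inE eqxx setD1K.
  by rewrite -cB -cB' [in RHS](cardsD1 e) sB'.
Qed.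

Lemma hpoly0 r : hpoly r set0 = 0. Proof. by rewrite /hpoly big_set0. Qed.

Lemma hpoly_mono E r N N' :
    {in N', forall F, F \subset E} -> N \subset N' ->
    matroidal r N -> matroidal r N' ->
  forall i, (hpoly r N)`_i <= (hpoly r N')`_i.
Proof.
have [k] := ubnP #|E|; elim: k E r N N' => // k IH E r N N'.
rewrite ltnS => le_k sE sN mN mN' i.
have [N'0 | N'0] := eqVneq N' set0.
  by move: sN; rewrite N'0 subset0 => /eqP->.
(* A basis of [N] is one of [N'] because the ranks agree; if [N] is empty, any basis of [N']
   serves. *)
have [B [BN' cB NB]] : exists B, [/\ B \in N', #|B| = r & N != set0 -> B \in N].
  have [N0 | N0] := eqVneq N set0.
    by have [_ _ _ /(_ N'0)[B ? ?]] := mN'; exists B.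
  by have [_ _ _ /(_ N0)[B BN ?]] := mN; exists B; rewrite (subsetP sN).
(* When the basis is all of [E], [N'] and a nonempty [N] are its powerset, with h-polynomial 1; an
   empty [N] gives 0. Otherwise some [e] off [B] can be deleted without loss of rank. *)
have [sEB | ] := boolP (E \subset B).
  have eB : B = E by apply/eqP; rewrite eqEsubset sEB sE.
  have powN (M : {set {set T}}) :
      M \subset N' -> matroidal r M -> B \in M -> hpoly r M = 1.
    move=> sM [dM _ _ _] BM; rewrite -(hpoly_powerset B) cB; congr hpoly.
    apply/setP => F; rewrite inE; apply/idP/idP => [/(subsetP sM)/sE | sFB].
      by rewrite eB.
    exact: dM BM sFB.
  rewrite (powN N') //; have [-> | /NB BN] := eqVneq N set0; last by rewrite powN.
  by rewrite hpoly0 coef0 coef1; case: eqP.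
case/subsetPn => e eE eB; rewrite (hpoly_del_link r N e) (hpoly_del_link r N' e) !coefD !coefXM.
have {}IH := IH (E :\ e).
have lt_k : (#|E :\ e| < k)%N by move: le_k; rewrite (cardsD1 e E) eE.
apply: lerD.
  apply: IH => //.
  - by move=> F; rewrite inE subsetD1 => /andP[/sE->].
  - by apply/subsetP => F; rewrite !inE => /andP[/(subsetP sN)->].
  - by apply: matroidal_del mN eB _ => /NB.
  - exact: matroidal_del mN' eB _.
case: eqP => // _; apply: IH => //; try exact: matroidal_link.
- move=> F; rewrite inE subsetD1 => /andP[-> /sE]; rewrite andbT.
  exact/subset_trans/subsetUr.
- by apply/subsetP => F; rewrite !inE => /andP[-> /(subsetP sN)].
Qed.

End MatroidHPoly.

(** * The dual matroid and complete partite matroids *)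

Section Dual.
Variable n : nat.
Implicit Types (D : {set {set 'I_n}}) (F G B : {set 'I_n}) (d : nat).

Definition dual_complex D : {set {set 'I_n}} :=
  [set G : {set 'I_n} | [exists F in facets D, [disjoint F & G]]].

(** A maximal face smaller than a basis could be enlarged by exchange. *)
Lemma matroidal_facets D d F :
  matroidal d D -> D != set0 -> (F \in facets D) = (F \in D) && (#|F| == d).
Proof.
move=> [_ xD bD rD] D0; rewrite inE; apply/maxsetP/andP => [[FD maxF] | [FD /eqP cF]].
  have [B BD cB] := rD D0; split=> //.
  have [|B' [B'D sFB' _ cB']] := exchange_extend xD BD FD; first by rewrite cB bD.
  by rewrite -(maxF _ B'D sFB') cB' cB.
split=> // G GD sFG; apply/esym/eqP; rewrite eqEcard sFG cF /=; exact: bD.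
Qed.

(** For exchange, let [F] miss the basis [B] and [G] the basis [C]. Extending [C :\: F] by elements
    of [B] gives a basis [B'] that still misses [F]; any element of [G :\: F] outside [B'] can then
    be added to [F]. *)
Lemma matroidal_dual D d :
  matroidal d D -> D != set0 -> matroidal (n - d) (dual_complex D).
Proof.
move=> mD D0; have fE F := matroidal_facets F mD D0.
have [dD xD bD rD] := mD.
have compl B : #|B| = d -> (n - d)%N = #|~: B|.
  by move=> <-; rewrite [RHS]cardsCs setCK card_ord.
split.
- move=> F G; rewrite !inE => /exists_inP[B fB dB] sGF; apply/exists_inP; exists B => //.
  exact: disjointWr sGF dB.
- move=> F G; rewrite !inE => /exists_inP[B]; rewrite fE => /andP[BD /eqP cB] dBF.
  case/exists_inP => C; rewrite fE => /andP[CD /eqP cC] dCG ltFG.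
  have CFD : C :\: F \in D := dD _ _ CD (subsetDl _ _).
  have [|B' [B'D sB' sB'' cB']] := exchange_extend xD BD CFD; first by rewrite cB bD.
  have dB'F : [disjoint B' & F].
    apply: disjointWl sB'' _.
    by rewrite disjoints_subset subUset -!disjoints_subset dBF disjoints_subset setDE subsetIr.
  (* If [G :\: F] were inside [B'], then [B'] would contain the disjoint sets [G :\: F] and
     [C :\: F], which have more than [d] elements together. *)
  have [sGB|] := boolP (G :\: F \subset B').
    have dGC : [disjoint G :\: F & C :\: F].
      rewrite disjoint_sym; apply: disjointWl (subsetDl _ _) _.
      exact: disjointWr (subsetDl _ _) dCG.
    have : (#|(G :\: F) :|: (C :\: F)| <= d)%N.
      by rewrite -cB -cB'; apply: subset_leq_card; rewrite subUset sGB.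
    rewrite cardsU; move: dGC; rewrite -setI_eq0 => /eqP->; rewrite cards0 subn0.
    (* [G] and [C] meet [F] in disjoint pieces, so [G :\: F] and [C :\: F] have together at least
       |G| + d - |F| > d elements. *)
    have : (#|F :&: G| + #|F :&: C| <= #|F|)%N.
      have /eqP e0 : (F :&: G) :&: (F :&: C) == set0.
        by rewrite setIACA setIid [G :&: C]setIC; move: dCG;
           rewrite -setI_eq0 => /eqP->; rewrite setI0.
      have := cardsU (F :&: G) (F :&: C); rewrite e0 cards0 subn0 => <-.
      by apply: subset_leq_card; rewrite subUset !subsetIl.
    have := cardsID F G; have := cardsID F C.
    rewrite ![_ :&: F]setIC cC; lia.
  case/subsetPn => i; rewrite inE => /andP[iF iG] iB'; exists i; first by rewrite inE iF.
  rewrite inE; apply/exists_inP; exists B'; first by rewrite fE B'D cB' cB eqxx.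
  rewrite disjoint_sym disjoints_subset subUset sub1set inE iB' /=.
  by rewrite -disjoints_subset disjoint_sym.
- move=> F; rewrite inE => /exists_inP[B]; rewrite fE => /andP[BD /eqP cB] dBF.
  rewrite (compl _ cB); apply: subset_leq_card.
  by rewrite -disjoints_subset disjoint_sym.
- have [B BD cB] := rD D0; exists (~: B); last exact/esym/compl.
  rewrite inE; apply/exists_inP; exists B; first by rewrite fE BD cB eqxx.
  by rewrite disjoints_subset setCK.
Qed.

Lemma matroid_complex_matroidal D :
  matroid_complex D -> matroidal (max_face_card D) D.
Proof.
move=> [[D0 dD] xD _]; split=> // [F FD | _].
  by rewrite /max_face_card bigop.leq_bigmax_cond.
have D1 : (0 < #|D|)%N by apply/card_gt0P; exists set0.
have [B BD cB] := eq_bigmax_cond (fun F : {set 'I_n} => #|F|) D1.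
by exists B.
Qed.

Lemma dual_complex_sub D D' d :
    matroidal d D -> matroidal d D' -> D != set0 -> D \subset D' ->
  dual_complex D \subset dual_complex D'.
Proof.
move=> mD mD' D0 sD; have D'0 : D' != set0.
  by have /set0Pn[F FD] := D0; apply/set0Pn; exists F; apply: (subsetP sD).
apply/subsetP => G; rewrite !inE => /exists_inP[F fF dF]; apply/exists_inP; exists F => //.
move: fF; rewrite (matroidal_facets _ mD D0) (matroidal_facets _ mD' D'0).
by case/andP => /(subsetP sD)->.
Qed.

Lemma hpoly_dual_complex_perm (s : {perm 'I_n}) D D' r :
    (forall F, (s @: F \in facets D') = (F \in facets D)) ->
  hpoly r (dual_complex D') = hpoly r (dual_complex D).
Proof.
move=> sD; rewrite /hpoly (reindex_inj (imset_inj (@perm_inj _ s))) /=.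
apply: eq_big => [G | G _]; last by rewrite card_imset //; apply: perm_inj.
rewrite !inE; apply/exists_inP/exists_inP => [[F fF dF] | [F fF dF]].
  exists (s^-1%g @: F); first by rewrite -sD -imset_comp (eq_imset _ (permKV s)) imset_id.
  by rewrite -(imset_disjoint (@perm_inj _ s)) -imset_comp (eq_imset _ (permKV s)) imset_id.
exists (s @: F); first by rewrite sD.
by rewrite imset_disjoint //; apply: perm_inj.
Qed.

End Dual.

Section CompletePartite.
Variables (n p d : nat) (a : 'I_p -> nat).
Implicit Types (A : 'I_p -> {set 'I_n}) (F : {set 'I_n}).

(** Encodes the partition by a colour map [c], so that faces of the complete partite matroid become
    sets with distinct colours. *)
Lemma partition_of_type_class A :
  partition_of_type a A -> exists c : 'I_n -> 'I_p, forall v i, (v \in A i) = (c v == i).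
Proof.
move=> [_ dA cA].
have /fin_all_exists[c cP] v : exists i, v \in A i.
  by have := in_setT v; rewrite -cA => /bigcupP[i _ vi]; exists i.
exists c => v i; apply/idP/eqP => [vi | <- //].
apply/eqP/negPn/negP => /dA; rewrite -setI_eq0 => /eqP/setP/(_ v).
by rewrite !inE cP vi.
Qed.

Hypotheses (hp : (d <= p)%N) (ha : forall i, (0 < a i)%N).

(** A small set with distinct colours is completed to a generator by adding colours, which exist
    since [d <= p], with an element of each, which exists since the parts are nonempty. *)
Lemma mem_complete_partite A (c : 'I_n -> 'I_p) F :
    partition_of_type a A -> (forall v i, (v \in A i) = (c v == i)) ->
  reflect ((#|F| <= d)%N /\ {in F &, injective c}) (F \in complete_partite_matroid d A).
Proof.
move=> [cA _ _] cP; rewrite inE; apply: (iffP exists_inP) => [[G] | [leF injF]].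
  rewrite inE => /existsP[I /existsP[v /and3P[/eqP cI /forall_inP vI /eqP->]]] sF.
  have cv i : i \in I -> c (v i) = i by move=> /vI; rewrite cP => /eqP.
  split; first by rewrite (leq_trans (subset_leq_card sF)) // -cI leq_imset_card.
  move=> x y /(subsetP sF)/imsetP[i iI ->] /(subsetP sF)/imsetP[j jI ->].
  by rewrite !cv // => ->.
have /fin_all_exists[w wP] i : exists x, x \in A i.
  by apply/card_gt0P; rewrite cA.
(* [v] selects the element of [F] of colour [i] if there is one, and the arbitrary [w i]
   otherwise. *)
pose v := [ffun i => odflt (w i) [pick x in F | c x == i]].
have vP i : v i \in A i.
  by rewrite ffunE; case: pickP => //= x /andP[_]; rewrite cP.
have vF x : x \in F -> v (c x) = x.
  move=> xF; rewrite ffunE; case: pickP => [y /andP[yF /eqP /injF->] // | /(_ x)].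
  by rewrite xF eqxx.
have [I [sI cI]] : exists I : {set 'I_p}, c @: F \subset I /\ #|I| = d.
  have cF : #|c @: F| = #|F| by rewrite card_in_imset.
  have : (d - #|F| <= #|~: (c @: F)|)%N.
    by have := cardsC (c @: F); rewrite card_ord cF; lia.
  case/card_geqP => s [us ss sF]; exists ((c @: F) :|: [set x in s]); rewrite subsetUl.
  split=> //; rewrite cardsU (_ : _ :&: _ = set0) ?cards0; last first.
    apply/setP => i; rewrite !inE; apply/andP => -[iF /sF]; by rewrite inE iF.
  rewrite cF cardsE (card_uniqP us) ss; lia.
exists (v @: I).
  rewrite inE; apply/existsP; exists I; apply/existsP; exists v.
  by rewrite cI !eqxx /= andbT; apply/forall_inP.
apply/subsetP => x xF; apply/imsetP; exists (c x); last by rewrite vF.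
by apply: (subsetP sI); apply: imset_f.
Qed.

(** For exchange, the larger face shows more colours, so one of its elements has a colour absent
    from the smaller. Representatives of [d] colours form a basis. *)
Lemma matroidal_complete_partite A :
    partition_of_type a A ->
  set0 \in complete_partite_matroid d A /\ matroidal d (complete_partite_matroid d A).
Proof.
move=> tA; have [c cP] := partition_of_type_class tA.
have [cA dA uA] := tA.
have M F := mem_complete_partite F tA cP.
have S0 : set0 \in complete_partite_matroid d A.
  by apply/M; rewrite cards0; split=> // x; rewrite inE.
split=> //; split.
- move=> F G /M[leF injF] sGF; apply/M; split; first exact: leq_trans (subset_leq_card sGF) leF.
  by move=> x y /(subsetP sGF) xF /(subsetP sGF) yF; apply: injF.
- move=> F G /M[leF injF] /M[leG injG] ltFG.
  have /subsetPn[i /imsetP[g gG ->] gF] : ~~ (c @: G \subset c @: F).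
    apply: contraL ltFG => /subset_leq_card; rewrite !card_in_imset // -leqNgt //.
  have gnF : g \notin F by apply: contra gF; apply: imset_f.
  exists g; first by rewrite inE gnF.
  apply/M; split; first by rewrite cardsU1 gnF (leq_trans ltFG).
  move=> x y /setU1P[->|xF] /setU1P[->|yF] // cxy.
  - by case/imsetP: gF; exists y.
  - by case/imsetP: gF; exists x.
  - exact: injF.
- by move=> F /M[].
- move=> _; have /fin_all_exists[w wP] i : exists x, x \in A i.
    by apply/card_gt0P; rewrite cA.
  have cw i : c (w i) = i by have := wP i; rewrite cP => /eqP.
  have [|s [us ss _]] := @card_geqP _ [set: 'I_p] d _; first by rewrite cardsT card_ord.
  exists (w @: [set x in s]).
    apply/M; split.
      by apply: leq_trans (leq_imset_card _ _) _; rewrite cardsE (card_uniqP us) ss.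
    by move=> x y /imsetP[i _ ->] /imsetP[j _ ->]; rewrite !cw => ->.
  rewrite card_imset; last exact: can_inj cw.
  by rewrite cardsE (card_uniqP us) ss.
Qed.

(** Two vertices of the same part are not joined by an edge, so no face contains both. *)
Lemma matroid_class_sub D A :
    max_face_card D = d -> simplicial_complex D ->
    partition_of_type a A -> complete_partite A (skeleton_edge D) ->
  D \subset complete_partite_matroid d A.
Proof.
move=> dD [_ sD] tA pA; have [c cP] := partition_of_type_class tA.
apply/subsetP => F FD; apply/(mem_complete_partite _ tA cP); split.
  by rewrite -dD /max_face_card bigop.leq_bigmax_cond.
move=> x y xF yF cxy; apply/eqP/negPn/negP => nxy.
have := pA x y; rewrite /skeleton_edge nxy (sD F) //; last by rewrite subUset !sub1set xF.
by move/esym/negP; apply; apply/existsP; exists (c x); rewrite !cP cxy eqxx.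
Qed.

Lemma partition_of_type_perm A A' :
    partition_of_type a A -> partition_of_type a A' ->
  exists s : {perm 'I_n}, forall v i, (s v \in A i) = (v \in A' i).
Proof.
move=> tA tA'; have [c cP] := partition_of_type_class tA.
have [c' cP'] := partition_of_type_class tA'.
have [cA _ _] := tA; have [cA' _ _] := tA'.
pose f v := nth v (enum (A (c' v))) (index v (enum (A' (c' v)))).
have lt_f v : (index v (enum (A' (c' v))) < size (enum (A (c' v))))%N.
  by rewrite -cardE cA -cA' cardE index_mem mem_enum cP'.
have cf v : c (f v) = c' v.
  by apply/eqP; rewrite -cP -mem_enum mem_nth.
have f_inj : injective f.
  move=> x y fxy; have cxy : c' x = c' y by rewrite -!cf fxy.
  have lt_x := lt_f x; have lt_y := lt_f y.
  move: fxy; rewrite /f -cxy in lt_y *; rewrite (set_nth_default x y) // => /eqP.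
  rewrite nth_uniq ?enum_uniq // => /eqP e_ind.
  rewrite -(nth_index x (s := enum (A' (c' x))) (x := x)) ?mem_enum ?cP' //.
  by rewrite e_ind nth_index // mem_enum cP' cxy.
by exists (perm f_inj) => v i; rewrite permE cP cP' cf.
Qed.

Lemma hpoly_dual_complete_partite A A' r :
    partition_of_type a A -> partition_of_type a A' ->
  hpoly r (dual_complex (complete_partite_matroid d A)) =
  hpoly r (dual_complex (complete_partite_matroid d A')).
Proof.
move=> tA tA'; have [s sP] := partition_of_type_perm tA tA'.
have [S0 mA] := matroidal_complete_partite tA.
have [S0' mA'] := matroidal_complete_partite tA'.
have [c cP] := partition_of_type_class tA.
have [c' cP'] := partition_of_type_class tA'.
have cs v : c (s v) = c' v by apply/eqP; rewrite -cP sP cP'.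
apply: (hpoly_dual_complex_perm (s := s)) => F.
rewrite (matroidal_facets _ mA) ?(matroidal_facets _ mA') //; last by apply/set0Pn; exists set0.
  rewrite card_imset; last exact: perm_inj.
  congr (_ && _); apply/(mem_complete_partite _ tA cP)/(mem_complete_partite _ tA' cP').
    rewrite card_imset; last exact: perm_inj.
    case=> leF injF; split=> // x y xF yF cxy; apply: (@perm_inj _ s).
    by apply: injF; rewrite ?imset_f // !cs.
  rewrite card_imset; last exact: perm_inj.
  case=> leF injF; split=> // _ _ /imsetP[x xF ->] /imsetP[y yF ->].
  by rewrite !cs => /injF->.
by apply/set0Pn; exists set0.
Qed.

End CompletePartite.

(** * Hilbert functions of monomial quotients *)

Section VariableIdeals.
Variables (K : fieldType) (n : nat).
Implicit Types (F : {set 'I_n}) (p q : {mpoly K[n]}) (m : 'X_{1..n}).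

(** A ring morphism into a domain with kernel [var_ideal F]; it gives a boolean membership test and
    primality. *)
Definition kill F q : {mpoly K[n]} :=
  q \mPo [tuple if i \in F then 0 else 'X_i | i < n].

Lemma mcoeff_kill F q m :
  (kill F q)@_m = if [forall i in F, m i == 0%N] then q@_m else 0.
Proof.
rewrite /kill comp_mpolyEX raddf_sum /=.
transitivity (\sum_(u <- msupp q)
    if [forall i in F, m i == 0%N] then (q@_u *: 'X_[u])@_m else 0); last first.
  case: ifP => _; last by rewrite big1.
  by rewrite [q in RHS]mpolyE raddf_sum.
apply: eq_bigr => u _; rewrite !mcoeffZ comp_mpolyX mcoeffX.
have [/forall_inP uF | /forall_inPn[i iF ui]] := boolP [forall i in F, u i == 0%N].
  rewrite (eq_bigr (fun i => 'X_i ^+ u i)) => [|i _]; last first.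
    by rewrite tnth_mktuple; case: ifP => // /uF/eqP->.
  rewrite -mpolyXE_id mcoeffX; case: eqP => [<-|_]; last by rewrite mulr0 if_same.
  by rewrite (introT forall_inP uF).
rewrite (bigD1 i) //= tnth_mktuple iF expr0n (negbTE ui) mul0r mcoeff0 mulr0.
case: eqP => [<-|_]; last by rewrite mulr0 if_same.
by case: ifP => // /forall_inP/(_ i iF); rewrite (negbTE ui).
Qed.

Lemma var_ideal_mulX F i q : i \in F -> var_ideal F (q * 'X_i).
Proof.
move=> iF; exists (fun j => if j == i then q else 0).
by rewrite (bigD1 i) //= eqxx big1 ?addr0 => [|j /andP[_ /negbTE->]] //; rewrite mul0r.
Qed.

Lemma var_idealP F q :
  var_ideal F q <-> forall m, (forall i, i \in F -> m i = 0%N) -> q@_m = 0.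
Proof.
split=> [[c ->] m mF | q0].
  rewrite raddf_sum big1 // => i iF; apply/memN_msupp_eq0.
  rewrite (perm_mem (msuppMX _ _)); apply/mapP => -[u _ def_m].
  by move: (mF i iF); rewrite def_m mnmDE mnm1E eqxx.
have I0 : var_ideal F (0 : {mpoly K[n]}).
  by exists (fun=> 0); rewrite big1 // => i _; rewrite mul0r.
have ID p p' : var_ideal F p -> var_ideal F p' -> var_ideal F (p + p').
  move=> [c ->] [c' ->]; exists (fun i => c i + c' i); rewrite -big_split.
  by apply: eq_bigr => i _; rewrite mulrDl.
rewrite [q]mpolyE big_seq; apply: big_ind => // m mq.
have /forall_inPn[i iF mi] : ~~ [forall i in F, m i == 0%N].
  apply: contraL mq => /forall_inP mF; rewrite -mcoeff_eq0; apply/eqP.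
  by apply: q0 => i /mF/eqP.
have := var_ideal_mulX (q@_m *: 'X_[(m - U_(i))%MM]) iF.
by rewrite -scalerAl -mpolyXD submK // lep1mP.
Qed.

Lemma kill_eq0 F q : reflect (var_ideal F q) (kill F q == 0).
Proof.
apply: (iffP eqP) => [k0 | /var_idealP q0].
  apply/var_idealP => m mF; have := mcoeff_kill F q m; rewrite k0 mcoeff0.
  by rewrite ifT //; apply/forall_inP => i /mF->.
apply/mpolyP => m; rewrite mcoeff_kill mcoeff0.
by case: ifP => // /forall_inP mF; apply: q0 => i /mF/eqP.
Qed.

Definition mnm_supp m : {set 'I_n} := [set i | m i != 0%N].

(** A monomial lies outside [var_ideal F] exactly when its support misses [F], so the monomials
    outside the cover ideal are those supported on faces of the dual. *)
Lemma cover_idealP (D : {set {set 'I_n}}) q :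
  cover_ideal D q <-> forall m, mnm_supp m \in dual_complex D -> q@_m = 0.
Proof.
split=> [Iq m | q0 F fF].
  rewrite inE => /exists_inP[F fF dF]; have /var_idealP := Iq F fF; apply=> i iF.
  by have := disjointFr dF iF; rewrite inE => /negbFE/eqP.
apply/var_idealP => m mF; apply: q0; rewrite inE; apply/exists_inP; exists F => //.
by rewrite disjoints_subset; apply/subsetP => i /mF mi; rewrite !inE mi eqxx.
Qed.

End VariableIdeals.

Section HilbertFunction.
Variables (K : fieldType) (n : nat) (I : {mpoly K[n]} -> Prop) (N : {set {set 'I_n}}).
Hypothesis IP : forall q, I q <-> forall m, mnm_supp m \in N -> q@_m = 0.

Definition box_supp b (f : {ffun 'I_n -> 'I_b.+1}) : {set 'I_n} :=
  [set i | f i != 0%N :> nat].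

(* The number of exponent vectors of degree [k] with support in [N] and entries at most [b];
   for [k <= b] the last condition is void. *)
Definition box_count b k :=
  #|[set f : {ffun 'I_n -> 'I_b.+1} | (box_supp f \in N) & (\sum_i f i == k)%N]|.

(** The monomials of degree [k] with support in [N] form a basis of the quotient. The bound [c k]
    puts their exponents in a finite type; leaving it free lets different bounds be compared. *)
Lemma hilbert_function_box (c : nat -> nat) :
    (forall k, (k <= c k)%N) ->
  hilbert_function_quotient I (fun k => box_count (c k) k).
Proof.
move=> le_c k; rewrite /box_count; set S := [set f | _ & _].
pose mon (f : {ffun 'I_n -> 'I_(c k).+1}) := [multinom (f i : nat) | i < n].
have monE f i : mon f i = f i by rewrite mnmE.
have mon_inj : injective mon.
  by move=> f g /mnmP fg; apply/ffunP => i; apply/val_inj; rewrite /= -!monE fg.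
have mon_supp f : mnm_supp (mon f) = box_supp f by apply/setP => i; rewrite !inE monE.
have mon_deg f : mdeg (mon f) = (\sum_i f i)%N.
  by rewrite mdegE; apply: eq_bigr => i _; rewrite monE.
have degS (j : 'I_#|S|) : mdeg (mon (enum_val j)) = k.
  by have := enum_valP j; rewrite inE mon_deg => /andP[_ /eqP].
exists (fun j => 'X_[mon (enum_val j)]); split=> [j|q qk].
  by rewrite dhomogX /= degS.
have coefE (s : {ffun 'I_#|S| -> K}) j :
    (q - \sum_j s j *: 'X_[mon (enum_val j)])@_(mon (enum_val j)) =
    q@_(mon (enum_val j)) - s j.
  rewrite mcoeffB raddf_sum /= (bigD1 j) //= big1 ?addr0 => [|j' ne].
    by rewrite mcoeffZ mcoeffX eqxx mulr1.
  by rewrite mcoeffZ mcoeffX (inj_eq mon_inj) (inj_eq enum_val_inj) (negbTE ne) mulr0.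
exists [ffun j => q@_(mon (enum_val j))]; split=> [|s /IP Is].
  apply/IP => m mN; have [mk | mk] := eqVneq (mdeg m) k; last first.
    rewrite mcoeffB (dhomog_nemf_coeff qk mk) raddf_sum /= big1 ?subr0 // => j _.
    rewrite mcoeffZ mcoeffX; case: eqP => [em|_]; last by rewrite mulr0.
    by rewrite -em degS eqxx in mk.
  pose f := [ffun i => inord (m i) : 'I_(c k).+1].
  have def_m : mon f = m.
    apply/mnmP => i; rewrite monE ffunE inordK // ltnS (leq_trans _ (le_c k)) // -mk.
    by rewrite mdegE (bigD1 i) //= leq_addr.
  have fS : f \in S by rewrite inE -mon_supp -mon_deg def_m mN mk /=.
  by rewrite -def_m -(enum_rankK_in fS fS) coefE ffunE subrr.
apply/ffunP => j; rewrite ffunE; apply/eqP; rewrite -subr_eq0 -coefE; apply/eqP/Is.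
by rewrite mon_supp; have := enum_valP j; rewrite inE => /andP[].
Qed.

(* Both sides are values of Hilbert functions of the same quotient. *)
Lemma box_count_stable b k : (k <= b)%N -> box_count b k = box_count k k.
Proof.
move=> le_kb; have I0 : I 0 by apply/IP => m _; rewrite mcoeff0.
have Ilin c p q : I p -> I q -> I (c *: p + q).
  by move=> /IP Ip /IP Iq; apply/IP => m mN; rewrite mcoeffD mcoeffZ Ip // Iq // mulr0 addr0.
have Hb := @hilbert_function_box (maxn b) (fun k => leq_maxr b k).
have Hk := @hilbert_function_box id leqnn.
have := hilbert_function_quotient_le I0 Ilin Hb Hk k.
have := hilbert_function_quotient_le I0 Ilin Hk Hb k.
rewrite /= (maxn_idPl le_kb) => le1 le2.
by apply/eqP; rewrite eqn_leq le1 le2.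
Qed.

(** A polynomial stand-in for the Hilbert series, agreeing with it through degree [b]. *)
Definition box_series b : {poly int} :=
  \sum_(f : {ffun 'I_n -> 'I_b.+1} | box_supp f \in N) 'X^(\sum_i f i).

Lemma coef_box_series b k : (box_series b)`_k = (box_count b k)%:Z.
Proof.
rewrite /box_series coef_sum /box_count -sum1_card -[Posz _]natz natr_sum.
rewrite big_mkcond [RHS]big_mkcond.
apply: eq_bigr => f _; rewrite inE coefXn eq_sym; case: (_ \in N) => //=.
by case: eqP.
Qed.

Lemma box_seriesE b :
  box_series b = \sum_(G in N) (\sum_(v < b) 'X ^+ v.+1) ^+ #|G|.
Proof.
rewrite /box_series (partition_big (@box_supp b) (fun G => G \in N)) //=.
apply: eq_bigr => G GN.
(* [Q] expresses having support [G] coordinate by coordinate, so that the sum over exponent vectors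
   factors into a product. *)
pose Q (i : 'I_n) := [pred v : 'I_b.+1 | (v != 0%N :> nat) == (i \in G)].
transitivity (\sum_(f in family Q) \prod_i ('X^(f i) : {poly int})).
  apply: eq_big => [f|f _]; last by rewrite prodrXr.
  apply/andP/familyP => [[_ /eqP def_G] i | fQ]; first by rewrite !inE -def_G inE.
  have -> : box_supp f = G.
    by apply/setP => i; have := fQ i; rewrite !inE => /eqP.
  by rewrite GN.
rewrite -(bigA_distr_big_dep _ (fun _ v => 'X^(v : 'I_b.+1))) /=.
rewrite (bigID (fun i => i \in G)) /= [X in _ * X]big1 ?mulr1 => [|i iG]; last first.
  rewrite (big_pred1 ord0) //= => v; rewrite !inE (negbTE iG) -val_eqE /=.
  by rewrite eqbF_neg negbK.
rewrite -prodr_const; apply: eq_bigr => i iG.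
by rewrite iG big_mkcond big_ord_recl /= add0r.
Qed.

(** Multiplying t + ... + t^k by 1 - t gives t(1 - t^k), so the term of [G] becomes t^|G| (1 - t)^(e
    - |G|) up to degrees above k. *)
Lemma coef_hpoly_box e k :
    {in N, forall G : {set _}, (#|G| <= e)%N} ->
  (hpoly e N)`_k =
    \sum_(j < k.+1) ((1 - 'X : {poly int}) ^+ e)`_j * (box_count (k - j)%N (k - j)%N)%:Z.
Proof.
move=> le_e; transitivity ((1 - 'X) ^+ e * box_series k)`_k; last first.
  rewrite coefM; apply: eq_bigr => j _.
  by rewrite coef_box_series (box_count_stable (leq_subr j k)).
rewrite box_seriesE mulr_sumr /hpoly !coef_sum; apply: eq_bigr => G GN.
set g := #|G|; set U := \sum_(v < k) _.
have U1 : (1 - 'X) * U = 'X * (1 - 'X ^+ k).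
  rewrite (_ : U = 'X * \sum_(v < k) 'X ^+ v); last first.
    by rewrite mulr_sumr; apply: eq_bigr => v _; rewrite exprS.
  by rewrite mulrCA -opprB mulNr -subrX1 opprB.
rewrite -[in RHS](subnK (le_e G GN)) exprD -mulrA -exprMn U1 exprMn mulrCA -/g.
(* For g = 0 there is no error term; for g > 0 the factor ['X ^+ g] pushes the error from degree k
   to at least k + 1. *)
have [-> | g0] := posnP g; first by rewrite expr0 !mulr1.
have [P ->] : exists P : {poly int}, (1 - 'X ^+ k) ^+ g = 1 - 'X ^+ k * P.
  exists (\sum_(i < g) (1 - 'X ^+ k) ^+ i).
  have /eqP := subrX1 (1 - 'X ^+ k : {poly int}) g.
  by rewrite subr_eq => /eqP->; ring.
(* Modulo ['X ^+ k.+1] the factor [(1 - 'X ^+ k) ^+ g] is invisible next to ['X ^+ g]. *)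
transitivity ('X ^+ g * (1 - 'X) ^+ (e - g) -
    'X ^+ k.+1 * ('X ^+ g.-1 * (1 - 'X) ^+ (e - g) * P))`_k.
  by rewrite coefB (coefXnM k.+1) ltnSn subr0.
congr (polyseq _)`__; rewrite exprS (_ : 'X ^+ g = 'X * 'X ^+ g.-1); first ring.
by rewrite -exprS prednK.
Qed.

Lemma hilbert_hpoly e : {in N, forall G : {set _}, (#|G| <= e)%N} ->
  exists2 H, hilbert_function_quotient I H
    & forall k, (hpoly e N)`_k =
        \sum_(j < k.+1) ((1 - 'X : {poly int}) ^+ e)`_j * (H (k - j)%N)%:Z.
Proof.
move=> le_e; exists (fun k => box_count k k); first exact: (@hilbert_function_box id).
by move=> k; apply: coef_hpoly_box.
Qed.

End HilbertFunction.

(** * Krull dimension *)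

Section PrimeIdeals.
Variables (K : fieldType) (n : nat).
Local Notation S := {mpoly K[n]}.
Implicit Types (P Q : {pred S}) (F : {set 'I_n}) (f q : S).

Lemma idealr_closedM P : idealr_closed P -> forall f q, q \in P -> f * q \in P.
Proof. by move=> [P0 _ PD] f q qP; rewrite -[_ * _]addr0; apply: PD. Qed.

Lemma idealr_closedD P : idealr_closed P -> forall f q, f \in P -> q \in P -> f + q \in P.
Proof. by move=> [P0 _ PD] f q fP qP; rewrite -[f]mul1r; apply: PD. Qed.

Lemma idealr_closed_sum P (J : Type) (r : seq J) (A : pred J) (g : J -> S) :
  idealr_closed P -> (forall j, A j -> g j \in P) -> \sum_(j <- r | A j) g j \in P.
Proof.
move=> iP gP; apply: (big_ind (fun q => q \in P)) => //; first by case: iP.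
exact: idealr_closedD.
Qed.

(** [var_ideal F] as a boolean predicate, the form in which [prime_chain] takes its ideals. *)
Definition kill_ideal F : {pred S} := fun q => kill F q == 0.

Lemma kill_ideal_prime F : idealr_closed (kill_ideal F) /\ prime_idealr_closed (kill_ideal F).
Proof.
split; first split.
- by rewrite unfold_in /kill raddf0.
- by rewrite unfold_in /kill rmorph1 oner_eq0.
- move=> f u v; rewrite !unfold_in /kill rmorphD rmorphM /= => /eqP-> /eqP->.
  by rewrite mulr0 addr0.
by move=> u v; rewrite !unfold_in /kill rmorphM mulf_eq0.
Qed.

Lemma mem_kill_X F i : ('X_i \in kill_ideal F) = (i \in F).
Proof.
rewrite unfold_in; apply/kill_eq0/idP => [/var_idealP/(_ U_(i)%MM) | iF].
  apply: contraPT => iF; rewrite mcoeffXU eqxx => X0; have /eqP := oner_neq0 K.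
  by apply; apply: X0 => j jF; rewrite mnm1E; case: eqP jF iF => // -> ->.
by rewrite -[X in var_ideal _ X]mul1r; apply: var_ideal_mulX.
Qed.

(** Starting from the variables of the facet [F], the others are adjoined one at a time; each new
    variable witnesses strictness. *)
Lemma prime_chain_cover_ideal (D : {set {set 'I_n}}) F :
  F \in facets D -> exists P : nat -> {pred S}, prime_chain (@cover_ideal K n D) (n - #|F|) P.
Proof.
move=> fF; set e := enum (~: F).
have sz_e : size e = (n - #|F|)%N by rewrite -cardE cardsCs setCK card_ord.
pose G i := F :|: [set x in take i e].
exists (fun i => kill_ideal (G i)); split=> [i _|i lt_i|q Iq].
- exact: kill_ideal_prime.
- have n0 : (0 < n)%N by rewrite (leq_ltn_trans _ (leq_trans lt_i (leq_subr _ _))).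
  pose x0 := Ordinal n0.
  have sub : G i \subset G i.+1.
    rewrite setUS //; apply/subsetP => x.
    by rewrite !inE (take_nth x0) ?sz_e // mem_rcons inE orbC => ->.
  split=> [q|/(_ 'X_(nth x0 e i))].
    rewrite !unfold_in => /kill_eq0/var_idealP q0; apply/kill_eq0/var_idealP => m mG.
    by apply: q0 => j /(subsetP sub)/mG.
  rewrite !mem_kill_X /G (take_nth x0) ?sz_e //.
  have ne : nth x0 e i \notin F by rewrite -in_setC -mem_enum mem_nth ?sz_e.
  rewrite !inE (negbTE ne) mem_rcons inE eqxx /= => /(_ isT).
  have : uniq (take i.+1 e) by rewrite take_uniq // enum_uniq.
  by rewrite (take_nth x0) ?sz_e // rcons_uniq => /andP[/negbTE->].
rewrite unfold_in; apply/kill_eq0; rewrite (_ : G 0%N = F); first exact: Iq.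
by apply/setP => x; rewrite !inE take0 orbF.
Qed.

(** Otherwise each facet has a variable outside [P]. The product of these lies in the cover ideal,
    hence in [P], against primality. *)
Lemma prime_contains_facet (D : {set {set 'I_n}}) P :
    idealr_closed P -> prime_idealr_closed P -> (forall q, cover_ideal D q -> q \in P) ->
  exists2 F, F \in facets D & forall i, i \in F -> 'X_i \in P.
Proof.
move=> iP pP IP; have [_ P1 _] := iP.
have [/exists_inP[F fF /forall_inP FP] | noF] :=
  boolP [exists F in facets D, [forall i in F, ('X_i : S) \in P]]; first by exists F.
pose y F : S := if [pick i in F | ('X_i : S) \notin P] is Some i then 'X_i else 1.
have yP F : y F \notin P by rewrite /y; case: pickP => // i /andP[].
have : \prod_(F in facets D) y F \notin P.
  apply: (big_ind (fun q => q \notin P)) => // u v uP vP.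
  by apply/negP => /pP; rewrite (negbTE uP) (negbTE vP).
case/negP; apply: IP => F fF; rewrite (bigD1 F) //= mulrC {2}/y.
case: pickP => [i /andP[iF _] | noi]; first exact: var_ideal_mulX.
case/negP: noF; apply/exists_inP; exists F => //; apply/forall_inP => i iF.
by have := noi i; rewrite iF => /negbFE.
Qed.

Lemma var_ideal_mem P F q :
  idealr_closed P -> (forall i, i \in F -> 'X_i \in P) -> var_ideal F q -> q \in P.
Proof.
by move=> iP FP [c ->]; apply: idealr_closed_sum => // i /FP; apply: idealr_closedM.
Qed.

End PrimeIdeals.

(** * Algebraic independence along chains of primes *)

Section Independence.
Variables (K : fieldType) (n : nat).
Local Notation S := {mpoly K[n]}.
Implicit Types (P Q : {pred S}) (F : {set 'I_n}) (f q : S) (fs : seq S).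

(** Exponent lists of length [l] with entries below [N]. Bounding each entry separately lets sums
    over them split by the first exponent. *)
Fixpoint boxes (N l : nat) : seq (seq nat) :=
  if l is l'.+1 then [seq k :: s | k <- iota 0 N, s <- boxes N l'] else [:: [::]].

Fixpoint powers fs (s : seq nat) : S :=
  match fs, s with f :: fs', k :: s' => f ^+ k * powers fs' s' | _, _ => 1 end.

Definition comb N fs (c : seq nat -> K) : S :=
  \sum_(s <- boxes N (size fs)) c s *: powers fs s.

Lemma size_boxes N l : size (boxes N l) = (N ^ l)%N.
Proof. by elim: l => //= l IH; rewrite size_allpairs size_iota IH expnS. Qed.

Lemma boxes_uniq N l : uniq (boxes N l).
Proof.
elim: l => //= l IH; apply: allpairs_uniq => //; first exact: iota_uniq.
by move=> [k s] [k' s'] _ _ [-> ->].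
Qed.

Lemma mem_boxesS N l k s : (k :: s \in boxes N l.+1) = (k < N)%N && (s \in boxes N l).
Proof.
apply/allpairsP/andP => [[[k' s'] [/= + ? [-> ->]]]|[kN sN]].
  by rewrite mem_iota.
by exists (k, s); rewrite mem_iota.
Qed.

Lemma comb_cons N f fs c :
  comb N (f :: fs) c = \sum_(k < N) f ^+ k * comb N fs (fun s => c ((k : nat) :: s)).
Proof.
rewrite /comb /= big_allpairs_dep /= -[N in iota 0 N]subn0 -/(index_iota 0 N) big_mkord.
apply: eq_bigr => k _; rewrite mulr_sumr; apply: eq_bigr => s _.
by rewrite scalerAr.
Qed.

(** Modulo [Q] only the term [g 0] survives, so it lies in [Q] and vanishes. The rest is divisible
    by [f], which can be cancelled modulo the prime [P], and the argument repeats. *)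
Lemma prime_step_independent P Q f N (g : nat -> S) :
    idealr_closed P -> prime_idealr_closed P -> idealr_closed Q -> {subset P <= Q} ->
    f \in Q -> f \notin P -> (forall k, g k \in Q -> g k = 0) ->
  \sum_(k < N) f ^+ k * g k \in P -> forall k, (k < N)%N -> g k = 0.
Proof.
move=> iP pP iQ sPQ fQ fP; elim: N g => // N IH g g0.
rewrite big_ord_recl expr0 mul1r; under eq_bigr do rewrite exprS -mulrA.
rewrite -mulr_sumr => gP; have g00 : g 0%N = 0.
  apply: g0; rewrite -[g _](addrK (f * \sum_(i < N) f ^+ i * g i.+1)).
  apply: idealr_closedD => //; first exact: sPQ.
  by rewrite -mulrN mulrC; apply: idealr_closedM.
move: gP; rewrite g00 add0r => /pP; rewrite (negbTE fP) => /= gP [|k] //.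
by move=> lt_k; apply: (IH (g \o succn)) => // j; apply: g0.
Qed.

(** Induction on the chain from [P 1] on: an element of [P 1] outside [P 0] is put in front of a
    list independent modulo [P 1]. *)
Lemma prime_chain_independent I l (P : nat -> {pred S}) :
    prime_chain (K := K) (n := n) I l P ->
  exists2 fs, size fs = l
    & forall N c, comb N fs c \in P 0%N -> {in boxes N l, forall s, c s = 0}.
Proof.
elim: l I P => [|l IH] I P [pP sP _].
  have [[_ P1 _] _] := pP 0%N isT; have [iP _] := pP 0%N isT.
  exists [::] => // N c; rewrite /comb big_seq1 => cP s; rewrite inE => /eqP->.
  apply: contraNeq P1 => c0; rewrite -(scale1r 1) -(mulVf c0) -scalerA.
  by rewrite -mul_mpolyC; apply: idealr_closedM.
have [|fs sz_fs fsP] := IH (fun q => q \in P 1%N) (fun i => P i.+1).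
  by split=> // i; [apply: (pP i.+1) | apply: (sP i.+1)].
have [sP01 nP10] := sP 0%N isT.
have [f /(@imply_to_and (_ \in _))[fP1 /negP fP0]] := not_all_ex_not _ _ nP10.
have [iP0 pP0] := pP 0%N isT; have [iP1 pP1] := pP 1%N isT.
exists (f :: fs) => [|N c]; first by rewrite /= sz_fs.
rewrite comb_cons => cP [|k s]; first by case/allpairsP=> -[? ?] [].
rewrite mem_boxesS => /andP[kN sN].
(* The coefficient of [f ^+ k] is a combination of [fs]; if it lies in [P 1], independence there
   makes it 0. *)
pose g k := comb N fs (fun s => c (k :: s)).
have g0 j : g j \in P 1%N -> g j = 0.
  move/fsP => cj0; rewrite /g /comb big_seq big1 // => t.
  by rewrite sz_fs => /cj0->; rewrite scale0r.
apply: (fsP N (fun s => c (k :: s))) => //; rewrite -/(g k).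
rewrite (prime_step_independent iP0 pP0 iP1 sP01 fP1 fP0 g0 cP kN).
by case: iP1.
Qed.

(** Modulo [var_ideal F], a polynomial of degree at most [b] is determined by its coefficients at
    the [b.+1 ^ #|~: F|] monomials off [F] with exponents at most [b]; more polynomials than that
    satisfy a linear relation. *)
Lemma var_ideal_dependent F b r (g : 'I_r -> S) :
    (forall j, msize (g j) <= b.+1)%N -> (b.+1 ^ #|~: F| < r)%N ->
  exists2 u : 'rV[K]_r, u != 0 & var_ideal F (\sum_j u 0 j *: g j).
Proof.
move=> gb; pose C := pffun_on (ord0 : 'I_b.+1) (mem (~: F)) predT.
rewrite -[b.+1]card_ord -(card_pffun_on (ord0 : 'I_b.+1)) -/C => ltC.
pose mon (h : {ffun 'I_n -> 'I_b.+1}) := [multinom (h i : nat) | i < n].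
pose M := \matrix_(j < r, t < #|C|) (g j)@_(mon (enum_val t)).
have [u u0 /matrixP uM] : exists2 u : 'rV[K]_r, u != 0 & u *m M = 0.
  have : kermx M != 0.
    by rewrite kermx_eq0 /row_free neq_ltn (leq_ltn_trans (rank_leq_col _)).
  by case/rowV0Pn => u /sub_kermxP; exists u.
exists u => //; apply/var_idealP => m mF; rewrite raddf_sum /=.
have [lt_m | ge_m] := ltnP (mdeg m) b.+1; last first.
  rewrite big1 // => j _; rewrite mcoeffZ memN_msupp_eq0 ?mulr0 //.
  exact/msize_mdeg_ge/(leq_trans (gb j)).
have le_m i : (m i < b.+1)%N by rewrite (leq_trans _ lt_m) // ltnS mdegE (bigD1 i) //= leq_addr.
pose h := [ffun i => inord (m i) : 'I_b.+1].
have def_m : mon h = m by apply/mnmP => i; rewrite mnmE ffunE inordK.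
have hC : h \in C.
  apply/pffun_onP; split=> [|x _]; last exact: isT.
  apply/supportP => i; rewrite !inE negbK => /mF mi.
  by apply/val_inj; rewrite ffunE /= inordK mi.
have := uM 0 (enum_rank_in hC h); rewrite !mxE => uh; rewrite -[RHS]uh.
by apply: eq_bigr => j _; rewrite mxE mcoeffZ enum_rankK_in // def_m.
Qed.

Lemma msizeM_pred f q : (msize (f * q) <= (msize f + msize q).-1)%N.
Proof.
have [->|f0] := eqVneq f 0; first by rewrite mul0r msize0.
have [->|q0] := eqVneq q 0; first by rewrite mulr0 msize0.
by rewrite msizeM.
Qed.

Lemma msize_powers N M fs s :
    (forall f, f \in fs -> (msize f <= M)%N) -> s \in boxes N (size fs) ->
  (msize (powers fs s) <= (size fs * (N * M)).+1)%N.
Proof.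
elim: fs s => [|f fs IH] [|k s] fM //; rewrite ?msize1 //.
rewrite [size _]/= mem_boxesS => /andP[kN sN].
have fk j : (msize (f ^+ j) <= (j * M).+1)%N.
  elim: j => [|j IHj]; first by rewrite expr0 msize1.
  rewrite exprS (leq_trans (msizeM_pred _ _)) // mulSn.
  have := fM f (mem_head _ _); lia.
rewrite (leq_trans (msizeM_pred _ _)) //.
have := fk k; have := IH s (fun f' f'fs => fM f' (mem_behead (s := f :: fs) f'fs)) sN.
have : (k * M <= N * M)%N by rewrite leq_mul2r (ltnW kN) orbT.
rewrite mulSn; move: (msize _) (msize _) (k * M)%N (N * M)%N; lia.
Qed.

Lemma prime_chain_length I l (P : nat -> {pred S}) F :
    prime_chain (K := K) (n := n) I l P -> (forall i, i \in F -> 'X_i \in P 0%N) ->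
  (l <= #|~: F|)%N.
Proof.
move=> cP FP; rewrite leqNgt; apply/negP => lt_l.
have [fs sz_fs fsP] := prime_chain_independent cP.
have [pP _ _] := cP; have [iP _] := pP 0%N isT.
set m := #|~: F| in lt_l; pose M := (\max_(f <- fs) msize f)%N.
have fM f : f \in fs -> (msize f <= M)%N.
  by move=> ffs; apply: (@leq_bigmax_seq _ fs predT (fun f => msize f)).
(* The [N ^ l] products of powers with exponents below [N] have degree at most [b], while only
   [b.+1 ^ m <= (N * C) ^ m] monomials off [F] have exponents at most [b]. *)
pose C := (l * M).+2; pose N := (C ^ m).+1; pose b := (l * (N * M))%N.
have msN s : s \in boxes N l -> (msize (powers fs s) <= b.+1)%N.
  by rewrite /b -sz_fs => /msize_powers; apply.
have [||u u0 Iu] := @var_ideal_dependent F b (N ^ l) (fun j => powers fs (nth [::] (boxes N l) j)).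
- by move=> j; apply: msN; rewrite mem_nth // size_boxes.
(* As C^m < N and m < l, one has (N C)^m = N^m C^m < N^(m+1) <= N^l. *)
- have le_b : (b.+1 <= N * C)%N by rewrite /C /b mulnS mulnS; lia.
  have le_bm : (b.+1 ^ m <= (N * C) ^ m)%N by case: (m) => // m'; rewrite leq_exp2r.
  rewrite -/m (leq_ltn_trans le_bm) // expnMn (@leq_trans (N ^ m.+1)) //.
    by rewrite expnSr ltn_pmul2l // expn_gt0.
  by rewrite leq_pexp2l.
case/eqP: u0; apply/rowP => j; rewrite mxE.
(* [c] reads [u] as a function on exponent lists through their position in [boxes N l], with value 0
   elsewhere. *)
pose c s := odflt 0 (omap (u 0) (insub (index s (boxes N l)))).
have cE (i : 'I_(N ^ l)) : c (nth [::] (boxes N l) i) = u 0 i.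
  by rewrite /c index_uniq ?size_boxes ?boxes_uniq // valK.
rewrite -cE; apply: (fsP N); last by rewrite mem_nth // size_boxes.
apply: var_ideal_mem iP FP _; rewrite /comb sz_fs (big_nth [::]) size_boxes big_mkord.
by under eq_bigr do rewrite cE.
Qed.

(** A facet gives a chain of length n - d. Conversely, the first prime of any chain contains the
    variables of some facet, and all facets have the same size. *)
Lemma krull_dim_cover_ideal (D : {set {set 'I_n}}) d :
    facets D != set0 -> {in facets D, forall F : {set 'I_n}, #|F| = d} ->
  krull_dim_quotient (@cover_ideal K n D) (n - d).
Proof.
case/set0Pn => F fF cD; split.
  by have [P] := prime_chain_cover_ideal K fF; rewrite cD //; exists P.
move=> l P cP; have [pP _ IP] := cP; have [iP prP] := pP 0%N isT.
have [G fG GP] := prime_contains_facet iP prP IP.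
have -> : (n - d)%N = #|~: G| by rewrite cardsCs setCK card_ord (cD G fG).
exact: prime_chain_length cP GP.
Qed.

End Independence.

(** * The h-polynomial of the cover ideal and the comparison *)

Lemma h_polynomial_cover_ideal (K : fieldType) n d (D : {set {set 'I_n}}) :
    matroidal d D -> D != set0 ->
  h_polynomial_quotient (@cover_ideal K n D) (hpoly (n - d) (dual_complex D)).
Proof.
move=> mD D0; have fE F := matroidal_facets F mD D0.
have [_ _ le_nd _] := matroidal_dual mD D0.
have [H hH hE] := hilbert_hpoly (@cover_idealP K n D) le_nd.
exists (n - d)%N, H; split=> //; apply: krull_dim_cover_ideal => [|F].
  have [_ _ _ /(_ D0)[B BD cB]] := mD.
  by apply/set0Pn; exists B; rewrite fE BD cB eqxx.
by rewrite fE => /andP[_ /eqP].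
Qed.

Theorem theorem4p6 (K : fieldType) (n d p : nat) (a : 'I_p -> nat)
    (hd : (1 <= d)%N) (hp : (d <= p)%N) (ha : forall i, (0 < a i)%N)
    (hn : (\sum_(i < p) a i)%N = n)
    (A : 'I_p -> {set 'I_n}) (hA : partition_of_type a A)
    (D : {set {set 'I_n}}) (hD : matroid_class d a D) :
  exists h h0 : {poly int},
    [/\ h_polynomial_quotient (@cover_ideal K n D) h,
        h_polynomial_quotient
          (@cover_ideal K n (complete_partite_matroid d A)) h0
      & forall i : nat, h`_i <= h0`_i].
Proof.
have [mxD dD [A' [hA' pA']]] := hD.
have [cD _ _] := mxD; have [S0 mA] := matroidal_complete_partite hp ha hA.
have [S0' mA'] := matroidal_complete_partite hp ha hA'.
have mD : matroidal d D by rewrite -dD; apply: matroid_complex_matroidal.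
have D0 : D != set0 by apply/set0Pn; exists set0; case: cD.
have A0 : complete_partite_matroid d A != set0 by apply/set0Pn; exists set0.
have A0' : complete_partite_matroid d A' != set0 by apply/set0Pn; exists set0.
exists (hpoly (n - d) (dual_complex D)).
exists (hpoly (n - d) (dual_complex (complete_partite_matroid d A))).
split; [exact: h_polynomial_cover_ideal | exact: h_polynomial_cover_ideal|].
(* The partition [A'] read off from [D] may differ from [A], and [D] is contained only in the
   complete partite matroid on [A']. *)
rewrite (hpoly_dual_complete_partite hp ha _ hA hA').
apply: (@hpoly_mono _ [set: 'I_n]).
- by move=> F _; apply: subsetT.
- exact/(dual_complex_sub mD mA' D0)/(matroid_class_sub hp ha dD cD hA' pA').
- exact: matroidal_dual.
- exact: matroidal_dual.
Qed.
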